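(* Let $t$ be the morphism on $\{0,1,2\}^*$ defined by $t(0)=01120$, $t(1)=12001$, $t(2)=2$, and let $t^\omega(0)$ be its infinite fixed point starting with $0$. Then $t^\omega(0)$ contains exactly $6$ distinct palindromes (including the empty word) and is $2^+$-free. Moreover, every bi-infinite word over $\{0,1,2\}$ that is $\tfrac94$-free and contains at most $6$ distinct palindromes (including the empty word) has the same set of finite factors as one of the six words obtained from $t^\omega(0)$ by applying a permutation of the letters $\{0,1,2\}$.
   Context: For a nonempty finite word $u$ and a rational $r>1$, a word $v$ is an $r$-power (of $u$) if $v$ is a prefix of the infinite periodic word $uuu\cdots$ and $|v|/|u|=r$. A (finite, infinite or bi-infinite) word is $\beta$-free (resp. $\beta^+$-free) if none of its factors is an $r$-power with $r\ge\beta$ (resp. $r>\beta$). A palindrome is a finite word equal to its reversal; a word contains a palindrome if the palindrome is one of its factors. A morphism satisfies $t(uv)=t(u)t(v)$ for all words $u,v$; since $t(0)$ begins with $0$, $t^\omega(0)=\lim_{n\to\infty}t^n(0)$ is well defined. *)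

(* Defs.v *)
From mathcomp Require Import all_boot all_order all_fingroup all_algebra.
From mathcomp Require Import mathcomp_extra boolp classical_sets functions.
From mathcomp Require Import cardinality.

Set Implicit Arguments.
Unset Strict Implicit.
Unset Printing Implicit Defensive.

Import Order.TTheory GRing.Theory Num.Theory.
Local Open Scope classical_set_scope.
Local Open Scope ring_scope.

Notation letter := 'I_3.
Notation word := (seq letter).
Notation inf_word := (nat -> letter).
Notation biinf_word := (int -> letter).

Definition l0 : letter := Ordinal (isT : (0 < 3)%N).
Definition l1 : letter := Ordinal (isT : (1 < 3)%N).
Definition l2 : letter := Ordinal (isT : (2 < 3)%N).

Definition inf_prefix (v : word) (w : inf_word) : Prop :=
  v = mkseq w (size v).

Definition inf_factors (w : inf_word) : set word :=
  [set v | exists i : nat, v = mkseq (fun j => w (i + j)%N) (size v)].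

Definition biinf_factors (z : biinf_word) : set word :=
  [set v | exists i : int, v = mkseq (fun j => z (i + j%:Z)) (size v)].

(* The infinite periodic word uuu..., for nonempty u; the default letter l0
   is only reached when u is empty. *)
Definition periodic_word (u : word) : inf_word :=
  fun i => nth l0 u (i %% size u)%N.

Definition power_of (r : rat) (u v : word) : Prop :=
  [/\ u <> [::], 1 < r, inf_prefix v (periodic_word u)
    & (size v)%:R / (size u)%:R = r].

Definition is_power (r : rat) (v : word) : Prop := exists u, power_of r u v.

(* Freeness of a word depends only on its set of factors, so it
   is stated for the factor set F of a word. *)
Definition power_free (beta : rat) (F : set word) : Prop :=
  forall r v, F v -> beta <= r -> ~ is_power r v.

Definition power_plus_free (beta : rat) (F : set word) : Prop :=
  forall r v, F v -> beta < r -> ~ is_power r v.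

Definition palindromes (F : set word) : set word :=
  [set v | F v /\ rev v = v].

Definition morphism_of (f : letter -> word) (w : word) : word :=
  flatten (map f w).

Definition t_letter (a : letter) : word :=
  match val a with
  | 0%N => [:: l0; l1; l1; l2; l0]
  | 1%N => [:: l1; l2; l0; l0; l1]
  | _ => [:: l2]
  end.

Definition t : word -> word := morphism_of t_letter.

(* The limit of the words t^n(0): each is a prefix of the next, and
   t^(n+1)(0) is longer than n, so it determines the letter at position n;
   see [t_omega_limit]. *)
Definition t_omega : inf_word :=
  fun n => nth l0 (iter n.+1 t [:: l0]) n.

Lemma t_cat u v : t (u ++ v) = t u ++ t v.
Proof. by rewrite /t /morphism_of map_cat flatten_cat. Qed.

Lemma t_omega_limit n :
  (n < size (iter n t [:: l0]))%N /\ inf_prefix (iter n t [:: l0]) t_omega.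
Proof.
have t_size w : (size w <= size (t w))%N.
  elim: w => // a w IHw; rewrite -cat1s t_cat !size_cat leq_add //.
  by case: a => [[|[|[|]]]].
have step k : exists s, iter k.+1 t [:: l0] = iter k t [:: l0] ++ s /\ s != [::].
  elim: k => [|k [s [Hs s0]]]; first by exists [:: l1; l1; l2; l0].
  exists (t s); split; first by rewrite iterS {1}Hs t_cat.
  by rewrite -size_eq0 -lt0n (leq_trans _ (t_size s)) // lt0n size_eq0.
have big k : (k < size (iter k t [:: l0]))%N.
  elim: k => // k IHk; have [s [-> s0]] := step k.
  by rewrite size_cat -[k.+1]addn1 -addSn leq_add // lt0n size_eq0.
have mono m d : exists s, iter (d + m) t [:: l0] = iter m t [:: l0] ++ s.
  elim: d => [|d [s IHd]]; first by exists [::]; rewrite cats0.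
  have [s' [Hs' _]] := step (d + m)%N.
  by exists (s ++ s'); rewrite addSn Hs' IHd catA.
split=> //; apply: (@eq_from_nth _ l0); first by rewrite size_mkseq.
move=> i i_lt; rewrite nth_mkseq // /t_omega.
case: (leqP n i.+1) => [le_ni|lt_in].
  have [s] := mono n (i.+1 - n)%N.
  by rewrite subnK // => ->; rewrite nth_cat i_lt.
have [s] := mono i.+1 (n - i.+1)%N.
rewrite subnK 1?ltnW // => ->.
by rewrite nth_cat (ltn_trans (ltnSn i) (big i.+1)).
Qed.

(* Main.v *)
Require Import Defs.
From mathcomp Require Import all_boot all_order all_fingroup all_algebra.
From mathcomp Require Import mathcomp_extra boolp classical_sets functions.
From mathcomp Require Import cardinality.
From mathcomp Require Import zify lra.

(* Call a word cyclic if its factors of length 2 are among 00, 01, 11, 12, 20.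

   Overlap-freeness: in t(w), with w cyclic and overlap-free, every occurrence
   of 2012 splits as 20|12 at a boundary between two blocks t(a), and 2012
   occurs in every window of length 25.  Hence the two copies in an overlap of
   period at least 24 have the same block boundaries; as a block is determined
   by its first letter and by its last letter, the overlap comes from an
   overlap in w.  Smaller periods are excluded by enumeration.

   Uniqueness: enumerating the words of length 19 shows that z is cyclic up to
   a permutation of the letters.  Let h(u) count the letters of u other than 2.
   From 9/4-freeness we keep only that z has no factor uuv with v a prefix of
   uv, |u| <= 4|v| and h(u) <= 4h(v).  Unlike 9/4-freeness, this property passes
   from t(w) to w, because h(t(u)) = 4h(u) and |t(u)| = |u| + 4h(u); and by
   enumeration it forces two consecutive occurrences of 2012 to be separated by
   t(120), t(1120), t(1200) or t(11200).  So z can be desubstituted forever: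
   every factor of z of length at least 4 lies in t(v) for a strictly shorter
   v, down to words of length 3, and every t^n(0) occurs in z.  Everything is
   done on finite words with margins, so that no bi-infinite preimage of z has
   to be constructed. *)

Set Implicit Arguments.
Unset Strict Implicit.
Unset Printing Implicit Defensive.

(** * Enumeration of the words of a given length that avoid a pattern *)

Definition avoids (bad : pred word) (w : word) : Prop :=
  forall v : word, infix v w -> ~~ bad v.

Lemma avoids_infix bad v w : infix v w -> avoids bad w -> avoids bad v.
Proof. by move=> vw aw u uv; apply: aw; apply: infix_trans vw. Qed.

(** Words grow on the left and each suffix is tested once, so a pattern need only be detected when
    it is a prefix. *)
Fixpoint avoiders (bad : pred word) (n : nat) : seq word :=
  if n is m.+1 then
    [seq w <- [seq x :: w | w <- avoiders bad m, x <- [:: l0; l1; l2]] | ~~ bad w]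
  else [:: [::]].

Lemma letterP (x : letter) : x \in [:: l0; l1; l2].
Proof. by case: x => [[|[|[|]]]]. Qed.

Lemma avoidersP bad w : avoids bad w -> w \in avoiders bad (size w).
Proof.
elim: w => [|x w IHw] aw; first by rewrite inE.
rewrite /= mem_filter aw ?infix_refl //=.
have /IHw w_in : avoids bad w by apply: avoids_infix aw; exact: infix_cons.
exact: (allpairs_f (fun (w : word) x => x :: w) w_in (letterP x)).
Qed.

Lemma avoids_all bad (P : pred word) n w :
  all P (avoiders bad n) -> avoids bad w -> size w = n -> P w.
Proof. by move=> /allP Pall /avoidersP + size_w; rewrite size_w => /Pall. Qed.

Lemma avoids_all_le bad (P : pred word) n w :
  all (fun k => all P (avoiders bad k)) (iota 0 n.+1) ->
  avoids bad w -> size w <= n -> P w.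
Proof.
move=> /allP Pall aw le_wn; apply: (avoids_all _ aw (erefl _)).
by apply: Pall; rewrite mem_iota.
Qed.

(** * The patterns to avoid and the exhaustive checks *)

Definition adj_pairs : seq (letter * letter) :=
  [:: (l0, l0); (l0, l1); (l1, l1); (l1, l2); (l2, l0)].

Definition adj (x y : letter) := (x, y) \in adj_pairs.

Definition bad_adj (w : word) := if w is x :: y :: _ then ~~ adj x y else false.

Definition heavy (w : word) := count (predC1 l2) w.

Fixpoint lcp (s1 s2 : word) : nat :=
  match s1, s2 with
  | x :: s1', y :: s2' => if x == y then (lcp s1' s2').+1 else 0
  | _, _ => 0
  end.

(* Number of leading letters of w that agree with those p places further: w
   begins with a word of period p and length [p + match_len p w]. *)
Definition match_len (p : nat) (w : word) := lcp w (drop p w).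

(* With l maximal, [take l (drop p w)] is the longest v with uuv a prefix of w
   and v a prefix of uv, where u is the prefix of w of length p. *)
Definition bad_power (w : word) :=
  has (fun p => let l := match_len p w - p in
    if p <= 4 * l then heavy (take p w) <= 4 * heavy (take l (drop p w)) else false)
    (iota 1 (size w)).

Definition bad_q (w : word) := bad_adj w || bad_power w.

Definition l2012 := [:: l2; l0; l1; l2].

Definition returns : seq word :=
  [:: [:: l1; l2; l0]; [:: l1; l1; l2; l0]; [:: l1; l2; l0; l0]; [:: l1; l1; l2; l0; l0]].

(** 31 = 4 + 2 + 25: four letters of left context, the 20 before the boundary, and room for the
    longest [t r] followed by 12, which has 23 letters. *)
Lemma avoiders_q_return :
  all (fun w => prefix l2012 (drop 4 w) ==>
    has (fun r => prefix (t r ++ [:: l1; l2]) (drop 6 w)) returns)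
  (avoiders bad_q 31).
Proof. by vm_compute. Qed.

Lemma avoiders_q_2012 : all (infix l2012) (avoiders bad_q 28).
Proof. by vm_compute. Qed.

Lemma avoiders_q_short :
  all (fun k => all (fun v => infix v (iter 3 t [:: l0])) (avoiders bad_q k)) (iota 0 4).
Proof. by vm_compute. Qed.

Definition bad_overlap (w : word) :=
  has (fun p => p < match_len p w) (iota 1 (size w)).

Definition bad_o (w : word) := bad_adj w || bad_overlap w.

Definition cut (w : word) (j : nat) := size (t (take j w)).

(** Here and in the next two checks [i] ranges over the possible offsets in a first block, which has
    at most five letters; [t_localize] reduces arbitrary positions to these. *)
Lemma avoiders_o_2012 :
  all (fun k => all (fun w => all (fun i => (i + 24 < size (t w)) ==>
    has (fun q => prefix l2012 (drop (i + q) (t w))) (iota 0 21))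
  (iota 0 5)) (avoiders bad_o k)) (iota 0 10).
Proof. by vm_compute. Qed.

Lemma avoiders_o_cut :
  all (fun k => all (fun w => all (fun i => prefix l2012 (drop i (t w)) ==>
    has (fun j => cut w j == i + 2) (iota 0 (size w).+1))
  (iota 0 5)) (avoiders bad_o k)) (iota 0 5).
Proof. by vm_compute. Qed.

Lemma avoiders_o_overlap :
  all (fun k => all (fun w => all (fun i =>
    ~~ has (fun p => p < match_len p (drop i (t w))) (iota 1 23))
  (iota 0 5)) (avoiders bad_o k)) (iota 0 16).
Proof. by vm_compute. Qed.

(** An overlap of period at most 23 needs at most 47 letters; starting at an offset of at most 4, it
    ends within the first 51. *)
Lemma avoiders_o_size : all (fun w => 53 <= size (t w)) (avoiders bad_o 15).
Proof. by vm_compute. Qed.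

(** A match of length at least 5p/4 at distance p gives a prefix of period p and length at least
    9p/4. *)
Definition bad_power94 (w : word) :=
  has (fun p => 5 * p <= 4 * match_len p w) (iota 1 (size w)).

(** Lengths are cut at 5: this bounds the number of palindromes from below, and it is enough for the
    search to succeed. *)
Definition short_palindromes (w : word) :=
  undup [seq v <- [seq take j (drop i w) | i <- iota 0 (size w), j <- iota 0 6]
        | rev v == v].

(* [if] rather than [||], which vm_compute would evaluate on both sides. *)
Definition bad_z (w : word) :=
  if bad_power94 w then true else 6 < size (short_palindromes w).

Definition perms3 : seq word :=
  [:: [:: l0; l1; l2]; [:: l0; l2; l1]; [:: l1; l0; l2]; [:: l1; l2; l0];
      [:: l2; l0; l1]; [:: l2; l1; l0]].

Definition rename (s : word) (x : letter) := nth l0 s x.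

Definition adj_pairs_of (s : word) :=
  [seq (rename s x.1, rename s x.2) | x <- adj_pairs].

Definition pairs (w : word) := zip w (behead w).

(** Asking that the last 18 letters also show every pair of [s] is what lets neighbouring windows be
    compared: it forces them to share the permutation. *)
Lemma avoiders_z_adj : all (fun w => has (fun s =>
    [&& all (mem (adj_pairs_of s)) (pairs (take 18 w)),
        all (mem (pairs (take 18 w))) (adj_pairs_of s)
      & all (mem (pairs (behead w))) (adj_pairs_of s)]) perms3) (avoiders bad_z 19).
Proof. by vm_compute. Qed.

(* prefixP and infixP with witnesses in [word] rather than in a sequence type
   over the canonical eqType of letters, which lia would not identify with it. *)
Lemma word_prefixP {u v : word} : reflect (exists s : word, v = u ++ s) (prefix u v).
Proof. exact: prefixP. Qed.

Lemma word_infixP {u v : word} :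
  reflect (exists p s : word, v = p ++ u ++ s) (infix u v).
Proof. exact: infixP. Qed.

(** * Periodic prefixes and [match_len] *)

Lemma leq_lcp k s1 s2 : (k <= lcp s1 s2) =
  [&& k <= size s1, k <= size s2 & take k s1 == take k s2].
Proof.
elim: s1 s2 k => [|x s1 IH] [|y s2] [|k] //=; first by rewrite andbF.
rewrite eqseq_cons; case: eqP => [_|_] /=; last by rewrite !andbF.
by rewrite ltnS IH.
Qed.

Lemma leq_match_len k p w : (k <= match_len p w) =
  (k <= size w - p) && (take k w == take k (drop p w)).
Proof.
rewrite /match_len leq_lcp size_drop.
case: (leqP k (size w - p)) => //=; rewrite ?andbF //.
by move=> /leq_trans -> //; exact: leq_subr.
Qed.

Lemma match_len_nth p w i : p < match_len p w -> i <= p ->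
  nth l0 w (p + i) = nth l0 w i.
Proof.
rewrite leq_match_len => /andP[_ /eqP eq_w] le_ip.
by rewrite -nth_drop -(nth_take l0 (n0 := p.+1)) // -eq_w nth_take.
Qed.

Lemma match_len_size p w : p < match_len p w -> p + p < size w.
Proof. by rewrite leq_match_len => /andP[]; lia. Qed.

Lemma nth_match_len p (w : word) : p + p < size w ->
  (forall i, i <= p -> nth l0 w (p + i) = nth l0 w i) -> p < match_len p w.
Proof.
move=> size_w eq_w; rewrite leq_match_len; apply/andP; split; first by lia.
have szl : size (take p.+1 w) = p.+1 by rewrite size_takel //; lia.
have szr : size (take p.+1 (drop p w)) = p.+1 by rewrite size_takel // size_drop; lia.
apply/eqP/(@eq_from_nth _ l0); rewrite szl ?szr // => i lt_ip.
by rewrite !nth_take // nth_drop eq_w.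
Qed.

(** * How [t] acts on lengths, adjacent letters and powers *)

Lemma t_cons x w : t (x :: w) = t_letter x ++ t w.
Proof. by []. Qed.

Lemma size_t w : size (t w) = size w + 4 * heavy w.
Proof.
elim: w => // x w IHw; rewrite t_cons size_cat IHw /=.
by have := letterP x; rewrite !inE => /or3P[] /eqP -> /=; lia.
Qed.

Lemma heavy_t w : heavy (t w) = 4 * heavy w.
Proof.
rewrite /heavy; elim: w => // x w IHw; rewrite t_cons count_cat IHw /=.
by have := letterP x; rewrite !inE => /or3P[] /eqP -> /=; lia.
Qed.

Lemma t_prefix (u v : word) : prefix u v -> prefix (t u) (t v).
Proof. by move=> /word_prefixP[s ->]; rewrite t_cat prefix_prefix. Qed.

Lemma t_infix (u v : word) : infix u v -> infix (t u) (t v).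
Proof. by move=> /word_infixP[s1 [s2 ->]]; rewrite !t_cat infix_infix. Qed.

Lemma size_t_letter x : 0 < size (t_letter x) <= 5.
Proof. by have := letterP x; rewrite !inE => /or3P[] /eqP ->. Qed.

Lemma t_letter_first x : nth l0 (t_letter x) 0 = x.
Proof. by have := letterP x; rewrite !inE => /or3P[] /eqP ->. Qed.

Lemma t_letter_last x : nth l0 (t_letter x) (size (t_letter x)).-1 = x.
Proof. by have := letterP x; rewrite !inE => /or3P[] /eqP ->. Qed.

(** Each block [t(a)] begins and ends with a, so the pairs across block boundaries are those of the
    word itself. *)
Lemma path_adj_t x w : path adj x w -> path adj x (t w).
Proof.
elim: w x => // y w IHw x /= /andP[xy yw]; rewrite t_cons cat_path.
have -> : last x (t_letter y) = y.
  by have := letterP y; rewrite !inE => /or3P[] /eqP ->.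
rewrite IHw // andbT; move: xy {yw}.
by have := letterP y; rewrite !inE => /or3P[] /eqP -> /= ->.
Qed.

Lemma sorted_adj_t (w : word) : sorted adj w -> sorted adj (t w).
Proof.
case: w => // x w xw; have /path_adj_t : path adj x w by [].
rewrite t_cons; have := letterP x.
by rewrite !inE => /or3P[] /eqP -> tw.
Qed.

Lemma sorted_infix (T : eqType) (e : rel T) u v : infix u v -> sorted e v -> sorted e u.
Proof.
move=> /infixP[s1 [s2 ->]].
case/cat_sorted2 => _; case/cat_sorted2 => //.
Qed.

Lemma avoids_sorted (bad : pred word) (w : word) :
  (forall v, bad_adj v -> bad v) -> avoids bad w -> sorted adj w.
Proof.
move=> bad_sub; elim: w => // x [|y w] IHw // aw.
rewrite /= -[path _ _ _]/(sorted adj (y :: w)) IHw; last first.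
  by apply: avoids_infix aw; exact: infix_cons.
rewrite andbT; apply: contraT => nxy.
by have := aw _ (infix_refl _); rewrite bad_sub.
Qed.

Lemma sorted_adj_bad (w : word) : sorted adj w -> ~~ bad_adj w.
Proof. by case: w => // x [|y w] //= /andP[->]. Qed.

Lemma match_len_power p l (w : word) : 0 < l -> p + l <= match_len p w ->
  let u := take p w in let v := take l (drop p w) in
  [/\ size u = p, size v = l, prefix (u ++ u ++ v) w & prefix v (u ++ v)].
Proof.
move=> l_gt0; rewrite leq_match_len => /andP[le_lw /eqP eq_w] /=.
have uvE : take p w ++ take l (drop p w) = take (p + l) (drop p w).
  by rewrite -eq_w takeD.
split.
- by rewrite size_takel //; lia.
- by rewrite size_takel // size_drop; lia.
- rewrite uvE; apply/word_prefixP; exists (drop (p + l) (drop p w)).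
  by rewrite -catA !cat_take_drop.
- rewrite uvE; apply/word_prefixP; exists (drop l (take (p + l) (drop p w))).
  by rewrite -[LHS](cat_take_drop l) take_takel //; lia.
Qed.

(** Testing only the longest v loses nothing: lengthening v increases both |v| and h(v), hence
    preserves both inequalities. *)
Lemma bad_powerP (w : word) : reflect (exists u v : word,
    [/\ u != [::], prefix (u ++ u ++ v) w, prefix v (u ++ v),
       size u <= 4 * size v & heavy u <= 4 * heavy v]) (bad_power w).
Proof.
apply: (iffP hasP) => [[p]|[u [v [u0 /word_prefixP[s {w}->] vu le_size le_heavy]]]].
  rewrite mem_iota => /andP[p_gt0 lt_pw] /=; case: ifP => // le_size le_heavy.
  have [||sz_u sz_v uw vu] := @match_len_power p (match_len p w - p) w; try lia.
  exists (take p w), (take (match_len p w - p) (drop p w)); split => //.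
    by rewrite -size_eq0 sz_u; lia.
  by rewrite sz_u sz_v.
set w0 := (_ ++ s).
have size_w : size w0 = size u + (size u + (size v + size s)) by rewrite !size_cat; lia.
have drop_w : drop (size u) w0 = u ++ v ++ s.
  by rewrite /w0 -!catA drop_size_cat.
have /word_prefixP[s' vs'] := vu.
have le_match : size u + size v <= match_len (size u) w0.
  rewrite leq_match_len drop_w; apply/andP; split; first by lia.
  rewrite catA take_size_cat ?size_cat //.
  rewrite /w0 (_ : _ ++ s = (u ++ v) ++ s' ++ s); last first.
    by rewrite -(catA u (u ++ v)) {1}vs' -!catA.
  by rewrite take_size_cat ?size_cat.
exists (size u).
  by rewrite mem_iota lt0n size_eq0 u0 add1n ltnS size_w leq_addr.
have take_w : take (size u) w0 = u by rewrite /w0 -!catA take_size_cat.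
rewrite /=; set l := _ - size u; have le_vl : size v <= l by lia.
rewrite (_ : size u <= 4 * l) ?take_w; last by lia.
apply: (leq_trans le_heavy); rewrite leq_mul2l /= /heavy.
rewrite -(subnKC le_vl) takeD count_cat; apply: (leq_trans _ (leq_addr _ _)).
by rewrite drop_w catA vs' -catA take_size_cat.
Qed.

Lemma t_eq0 (w : word) : (t w == [::]) = (w == [::]).
Proof. by rewrite -!size_eq0 size_t; case: w. Qed.

Lemma avoids_q_t (w : word) : avoids bad_q (t w) -> avoids bad_q w.
Proof.
move=> atw v vw; rewrite negb_or; apply/andP; split.
  case: v vw => [|x [|y v]] //= vw; rewrite negbK.
  (* The boundary between [t(x)] and [t(y)] reads xy again. *)
  suff xy_tw : infix [:: x; y] (t w).
    by have := atw _ xy_tw; rewrite negb_or /= negbK => /andP[].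
  apply: infix_trans (t_infix vw); rewrite !t_cons.
  have [s ->] : exists s, t_letter y = y :: s.
    by have := letterP y; rewrite !inE => /or3P[] /eqP ->; eexists.
  have [s' ->] : exists s, t_letter x = s ++ [:: x].
    have := letterP x; rewrite !inE => /or3P[] /eqP ->.
    - by exists [:: l0; l1; l1; l2].
    - by exists [:: l1; l2; l0; l0].
    - by exists [::].
  by rewrite -catA; exact: (infix_infix s' [:: x; y]).
apply/negP => /bad_powerP[u [u' [u0 uw u'u le_size le_heavy]]].
have /negP[] := atw _ (t_infix vw).
(* The length inequality for the images is the length inequality for u and u' plus four times the
   one for [heavy]. *)
rewrite /bad_q; apply/orP; right; apply/bad_powerP; exists (t u), (t u').
rewrite t_eq0 -!t_cat !t_prefix //; split => //; rewrite ?size_t ?heavy_t; lia.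
Qed.

(** * Block boundaries and desubstitution of words avoiding [bad_q] *)

Lemma prefix_l (x a b : word) : size x <= size a -> prefix x (a ++ b) -> prefix x a.
Proof. by move=> le_xa; rewrite !prefixE takel_cat. Qed.

Lemma size_t_leq (w : word) : size (t w) <= 5 * size w.
Proof. by have le_w : heavy w <= size w := count_size _ _; rewrite size_t; lia. Qed.

Lemma cutS w j : j < size w ->
  cut w j.+1 = cut w j + size (t_letter (nth l0 w j)).
Proof.
by move=> lt_jw; rewrite /cut (take_nth l0) // -cats1 t_cat size_cat t_cons cats0.
Qed.

Lemma cut_leq w j k : j <= k -> cut w j <= cut w k.
Proof.
move=> /subnKC <-; rewrite /cut takeD t_cat size_cat; exact: leq_addr.
Qed.

Lemma cut_oversize w j : size w <= j -> cut w j = size (t w).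
Proof. by move=> le_wj; rewrite /cut take_oversize. Qed.

Lemma cut_find w a : a < size (t w) ->
  exists2 j, j < size w & cut w j <= a < cut w j.+1.
Proof.
elim: w a => // x w IHw a; rewrite t_cons size_cat => lt_a.
have [lt_ax|le_xa] := ltnP a (size (t_letter x)).
  by exists 0 => //; rewrite /cut take0 /= take0 t_cons cats0.
have [|j lt_jw /andP[le_ja lt_aj]] := IHw (a - size (t_letter x)); first by lia.
exists j.+1 => //.
have cutE k : cut (x :: w) k.+1 = size (t_letter x) + cut w k.
  by rewrite /cut /= t_cons size_cat.
rewrite !cutE; lia.
Qed.

Lemma nth_cut w j k : j < size w -> k < size (t_letter (nth l0 w j)) ->
  nth l0 (t w) (cut w j + k) = nth l0 (t_letter (nth l0 w j)) k.
Proof.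
move=> lt_jw lt_k; rewrite -{1}(cat_take_drop j w) t_cat nth_cat -/(cut w j).
rewrite ltnNge leq_addr /= addKn (drop_nth l0) // t_cons nth_cat lt_k //.
Qed.

(** Induction on the length of [y]: one image [t r] is split off at the boundary 20|12, and as it
    ends in 20 and is followed by 12 the same situation recurs. The process stops when fewer than 25
    letters are left to look ahead. *)
Lemma q_parse (y x : word) : avoids bad_q (x ++ [:: l2; l0] ++ y) -> 4 <= size x ->
  prefix [:: l1; l2] y -> exists w s : word, y = t w ++ s /\ size s <= 31.
Proof.
have [n] := ubnP (size y); elim: n => // n IHn in y x * => lt_yn aw x4 y12.
have [lt_y|le_y] := ltnP (size y) 25; first by exists [::], y; split => //; lia.
pose v := drop (size x - 4) x ++ [:: l2; l0] ++ take 25 y.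
have size_xd : size (drop (size x - 4) x) = 4 by rewrite size_drop; lia.
have size_v : size v = 31.
  by rewrite !size_cat size_xd size_takel.
have av : avoids bad_q v.
  apply: avoids_infix aw; apply/word_infixP.
  exists (take (size x - 4) x), (drop 25 y).
  by rewrite -{1}(cat_take_drop (size x - 4) x) -{1}(cat_take_drop 25 y) /v -!catA.
have /implyP := avoids_all avoiders_q_return av size_v.
have drop4 : drop 4 v = [:: l2; l0] ++ take 25 y.
  by rewrite -[in LHS]size_xd /v drop_size_cat.
have drop6 : drop 6 v = take 25 y.
  by rewrite (_ : 6 = 2 + 4) // -drop_drop drop4 /= drop0.
have /word_prefixP[y' yE] := y12.
have yd : prefix l2012 ([:: l2; l0] ++ take 25 y) by rewrite yE /= prefix0s.
rewrite drop4 drop6 yd => /(_ isT) /hasP[r r_in /(prefix_trans)/(_ (prefix_take _ _))].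
case/word_prefixP => y2 yr.
have [a ta] : exists a : word, t r = a ++ [:: l2; l0].
  have /allP/(_ _ r_in)/suffixP : all (fun r => suffix [:: l2; l0] (t r)) returns by [].
  by [].
have [||||w [s [y2w les]]] := IHn ([:: l1; l2] ++ y2) (x ++ [:: l2; l0] ++ a).
- move: lt_yn; rewrite yr ta !size_cat /=; lia.
- by move: aw; rewrite yr ta -!catA.
- by rewrite size_cat; lia.
- exact: prefix_prefix.
by exists (r ++ w), s; rewrite yr -catA y2w t_cat -catA.
Qed.

(** A first boundary is found in the 28 letters that follow the left context of four letters
    required by [q_parse]; a word of fewer than 32 letters goes entirely into [p]. *)
Lemma q_desubst (w : word) : avoids bad_q w ->
  exists p v s : word, [/\ w = p ++ t v ++ s, size p <= 40 & size s <= 40].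
Proof.
move=> aw; have [lt_w|le_w] := ltnP (size w) 32.
  by exists w, [::], [::]; split => //; [exact/esym/cats0 | lia].
have size_v : size (take 28 (drop 4 w)) = 28.
  by rewrite size_takel // size_drop; lia.
have av : avoids bad_q (take 28 (drop 4 w)).
  by apply: avoids_infix aw; apply: infix_trans (infix_take _ _) (infix_drop _ _).
have /word_infixP[a [b vE]] := avoids_all avoiders_q_2012 av size_v.
have size_w4 : size (take 4 w) = 4 by rewrite size_takel //; lia.
have wE : w = (take 4 w ++ a) ++ [:: l2; l0] ++ ([:: l1; l2] ++ b ++ drop 28 (drop 4 w)).
  rewrite -[LHS](cat_take_drop 4) -[in LHS](cat_take_drop 28 (drop 4 w)) vE.
  by rewrite -!catA.
move: aw; rewrite wE => /q_parse[||v [s [-> les]]].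
- by rewrite size_cat; lia.
- exact: prefix_prefix.
exists (take 4 w ++ a ++ [:: l2; l0]), v, s; split; rewrite -?catA //; last by lia.
by move/(congr1 size): vE; rewrite !size_cat /=; lia.
Qed.

Lemma q_contains n : exists M, forall w : word,
  avoids bad_q w -> M <= size w -> infix (iter n t [:: l0]) w.
Proof.
elim: n => [|n [M IHn]].
  exists 28 => w aw le_w.
  have size_v : size (take 28 w) = 28 by rewrite size_takel.
  have av := avoids_infix (infix_take w 28) aw.
  apply: infix_trans (infix_trans (avoids_all avoiders_q_2012 av size_v) (infix_take _ _)).
  by [].
(* At most 40 letters are lost at each end, and a block has at most five letters. *)
exists (5 * M + 80) => w aw le_w.
have [p [v [s [wE lep les]]]] := q_desubst aw.
have tvw : infix (t v) w by rewrite wE infix_infix.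
rewrite iterS; apply: (infix_trans _ tvw); apply: t_infix; apply: IHn.
  exact/avoids_q_t/(avoids_infix tvw aw).
by move: le_w (size_t_leq v); rewrite wE !size_cat; lia.
Qed.

Lemma avoids_q_sorted (w : word) : avoids bad_q w -> sorted adj w.
Proof. by apply: avoids_sorted => v; rewrite /bad_q => ->. Qed.

(** As 22 is not allowed, two adjacent letters include one whose block has five letters. *)
Lemma q_size_t (w : word) : avoids bad_q w -> 1 < size w -> size w + 4 <= size (t w).
Proof.
move=> /avoids_q_sorted; case: w => [|x [|y w]] //= /andP[xy _] _.
rewrite size_t leq_add2l (leq_pmulr 4) // /heavy -has_count /=.
move: xy; have := letterP x; have := letterP y.
by rewrite !inE => /or3P[] /eqP -> /or3P[] /eqP ->.
Qed.

(** Induction on the length bound: a factor of length at most l + 1 is covered by the block in which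
    it starts and the l - 1 next ones, that is, by the image of a word of length l. The margins keep
    this word well inside the desubstituted word. *)
Lemma q_factor l : exists M, forall x v y : word,
  avoids bad_q (x ++ v ++ y) -> size v <= l -> M <= size x -> M <= size y ->
  exists n, infix v (iter n t [:: l0]).
Proof.
have base l' : l' <= 3 -> forall x v y : word, avoids bad_q (x ++ v ++ y) ->
    size v <= l' -> exists n, infix v (iter n t [:: l0]).
  move=> le_l x v y aw le_v; exists 3.
  apply: (avoids_all_le avoiders_q_short); last exact: leq_trans le_l.
  by apply: avoids_infix aw; exact: infix_infix.
elim: l => [|l [M IHl]].
  by exists 0 => x v y aw le_v _ _; apply: base aw le_v.
have [lt_l|le_l] := ltnP l 3.
  by exists 0 => x v y aw le_v _ _; apply: base aw le_v.
exists (5 * M + 5 * l + 60) => x v y aw le_v le_x le_y.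
have [p [w [s [wE lep les]]]] := q_desubst aw.
have atw : avoids bad_q (t w) by apply: avoids_infix aw; rewrite wE infix_infix.
have aqw := avoids_q_t atw.
have size_tw : size x + (size v + size y) = size p + (size (t w) + size s).
  by move/(congr1 size): wE; rewrite !size_cat.
(* The position of [v] inside [t w]. *)
set a := size x - size p.
have vE : v = take (size v) (drop a (t w)).
  have : drop (size x) (x ++ v ++ y) = drop a (t w) ++ s.
    rewrite wE (_ : size x = a + size p); last by rewrite /a; lia.
    rewrite -drop_drop drop_size_cat // drop_cat ifT //; rewrite /a; lia.
  rewrite drop_size_cat // => /(congr1 (take (size v))).
  rewrite take_size_cat // take_cat size_drop; case: ltnP => // ge_v; rewrite /a in ge_v; lia.
have lt_a : a < size (t w) by rewrite /a; lia.
have [j lt_jw /andP[le_ja lt_aj]] := cut_find lt_a.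
have cut_le k : cut w k <= 5 * k.
  by apply: leq_trans (size_t_leq _) _; rewrite leq_mul2l size_take; case: ltnP => //; lia.
have size_tw' : size (t w) <= cut w j + 5 * (size w - j).
  rewrite -[in X in X <= _](cat_take_drop j w) t_cat size_cat leq_add2l.
  by apply: leq_trans (size_t_leq _) _; rewrite size_drop.
have := cut_le j.+1 => cut_j1.
have wj : w = take j w ++ take l (drop j w) ++ drop l (drop j w) by rewrite !cat_take_drop.
have le_jl : M + l <= size w - j by rewrite /a in le_ja; lia.
have [||||n n_v] := IHl (take j w) (take l (drop j w)) (drop l (drop j w)).
- by rewrite -wj.
- by rewrite size_take; case: ltnP.
- rewrite size_takel //; [rewrite /a in lt_aj; lia | lia].
- by rewrite !size_drop; lia.
exists n.+1; apply: infix_trans (t_infix n_v).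
rewrite vE; set u := take l _.
have twE : t w = t (take j w) ++ t u ++ t (drop l (drop j w)) by rewrite -!t_cat -wj.
have drop_aE : drop a (t w) = drop (a - cut w j) (t u ++ t (drop l (drop j w))).
  by rewrite twE drop_cat -/(cut w j) ltnNge le_ja.
have uE : u = nth l0 w j :: take l.-1 (drop j.+1 w).
  by rewrite /u (drop_nth l0) // -[in LHS](prednK (n := l)) //; lia.
have size_u' : size (take l.-1 (drop j.+1 w)) = l.-1.
  by rewrite size_takel // size_drop; lia.
(* Since l >= 3, at least two blocks follow the first one; together they have at least l + 3
   letters, enough to reach the end of [v]. *)
have : size (take l.-1 (drop j.+1 w)) + 4 <= size (t (take l.-1 (drop j.+1 w))).
  apply: q_size_t; last by rewrite size_u'; lia.
  by apply: avoids_infix aqw; apply: infix_trans (infix_take _ _) (infix_drop _ _).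
rewrite size_u' => size_tu'.
have size_tu : size (t u) = size (t_letter (nth l0 w j)) + size (t (take l.-1 (drop j.+1 w))).
  by rewrite uE t_cons size_cat.
rewrite cutS // in lt_aj.
rewrite drop_aE drop_cat ifT; last by lia.
rewrite takel_cat; last by rewrite size_drop; lia.
by apply: infix_trans (infix_take _ _) (infix_drop _ _).
Qed.

(** * Preservation of overlap-freeness by [t] *)

(** Transfers a local question about [t w] at [i] to the image of at most [m.+1] letters, at an
    offset below 5; either the full [m.+1] letters are available or they run to the end of [w]. *)
Lemma t_localize (w : word) m i : i < size (t w) ->
  exists j i', let u := take m.+1 (drop j w) in
  [/\ i = cut w j + i', i' < size (t_letter (nth l0 w j)) <= 5, size u <= m.+1,
      u = nth l0 w j :: behead u &
      drop i (t w) = drop i' (t u) ++ t (drop (j + m.+1) w) /\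
      (size u = m.+1 \/ drop (j + m.+1) w = [::])].
Proof.
move=> lt_i; have [j lt_jw /andP[le_ji lt_ij]] := cut_find lt_i.
have uE : take m.+1 (drop j w) = nth l0 w j :: take m (drop j.+1 w).
  by rewrite (drop_nth l0).
have /andP[_ le5] := size_t_letter (nth l0 w j).
rewrite cutS // in lt_ij.
exists j, (i - cut w j); split.
- by rewrite subnKC.
- by rewrite le5 andbT; lia.
- by rewrite size_take_min geq_minl.
- by rewrite uE.
split; last first.
  have [le_m|lt_m] := leqP m.+1 (size (drop j w)).
    by left; rewrite size_takel.
  by right; apply: drop_oversize; rewrite size_drop in lt_m; lia.
have wE : w = take j w ++ take m.+1 (drop j w) ++ drop (j + m.+1) w.
  by rewrite addnC -drop_drop !cat_take_drop.
rewrite {1}wE !t_cat drop_cat -/(cut w j) ltnNge le_ji /= drop_cat ifT //.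
by rewrite uE t_cons size_cat; lia.
Qed.

Lemma avoids_o_sorted (w : word) : avoids bad_o w -> sorted adj w.
Proof. by apply: avoids_sorted => v; rewrite /bad_o => ->. Qed.

Lemma avoids_take_drop bad m j (w : word) : avoids bad w -> avoids bad (take m (drop j w)).
Proof.
by move=> aw; apply: avoids_infix aw; apply: infix_trans (infix_take _ _) (infix_drop _ _).
Qed.

Lemma o_sync (w : word) i : avoids bad_o w -> prefix l2012 (drop i (t w)) ->
  exists2 j, j <= size w & cut w j = i + 2.
Proof.
move=> aw pi; have lt_i : i < size (t w).
  by move/size_prefix: pi; rewrite size_drop /=; lia.
have [j [i' /= [iE /andP[lt_i' le5] le_m uE [dropE m_or]]]] := t_localize 3 lt_i.
set u := take 4 (drop j w) in le_m uE dropE m_or *.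
have au : avoids bad_o u by exact: avoids_take_drop.
have pu : prefix l2012 (drop i' (t u)).
  move: pi; rewrite dropE; case: m_or => [size_u|->]; last by rewrite cats0.
  apply: prefix_l; rewrite size_drop.
  (* The three blocks after the first have at least four letters, so a 2012 starting in the first
     block ends inside [t u]. *)
  have := avoids_all (n := 4) (P := fun v => 4 <= size (t v) - size (t_letter (head l0 v))).
  move=> /(_ bad_o u) /(_ isT au size_u).
  rewrite uE /=; lia.
have /allP := avoids_all_le avoiders_o_cut au le_m.
have i'_in : i' \in iota 0 5 by rewrite mem_iota; lia.
move=> /(_ _ i'_in) /implyP /(_ pu) /hasP[k]; rewrite mem_iota ltnS => /andP[_ le_ku] /eqP kE.
have le_k4 : k <= 4 by exact: leq_trans le_ku le_m.
exists (j + k).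
  move: le_ku; rewrite /u size_take_min size_drop leq_min => /andP[_].
  case: (leqP j (size w)); move: uE; rewrite /u; first by lia.
  by move=> /[swap] /ltnW /drop_oversize ->.
rewrite /cut takeD t_cat size_cat -/(cut w j) iE -addnA -kE /cut /u take_takel //.
Qed.

Lemma o_2012 (w : word) i : avoids bad_o w -> i + 24 < size (t w) ->
  exists2 q, q <= 20 & prefix l2012 (drop (i + q) (t w)).
Proof.
move=> aw lt_i24; have lt_i : i < size (t w) by lia.
have [j [i' /= [iE /andP[lt_i' le5] le_m uE [dropE m_or]]]] := t_localize 8 lt_i.
set u := take 9 (drop j w) in le_m uE dropE m_or *.
have au : avoids bad_o u by exact: avoids_take_drop.
have lt_i'u : i' + 24 < size (t u).
  case: m_or => [size_u|r0].
    have := avoids_all (n := 9) (P := fun v => 29 <= size (t v)).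
    by move=> /(_ bad_o u isT au size_u); lia.
  move/(congr1 size): dropE; rewrite r0 cats0 !size_drop; lia.
have /allP := avoids_all_le avoiders_o_2012 au le_m.
have i'_in : i' \in iota 0 5 by rewrite mem_iota; lia.
move=> /(_ _ i'_in) /implyP /(_ lt_i'u) /hasP[q]; rewrite mem_iota => /andP[_ lt_q] pq.
exists q; first by lia.
rewrite addnC -drop_drop dropE drop_cat size_drop ifT; last by lia.
by rewrite drop_drop addnC prefix_catl.
Qed.

Lemma o_small (w : word) i p : avoids bad_o w -> 0 < p < 24 ->
  ~~ (p < match_len p (drop i (t w))).
Proof.
move=> aw /andP[p_gt0 lt_p]; apply/negP => lt_pm; have := match_len_size lt_pm.
rewrite size_drop => size_p; have lt_i : i < size (t w) by lia.
have [j [i' /= [iE /andP[lt_i' le5] le_m uE [dropE m_or]]]] := t_localize 14 lt_i.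
set u := take 15 (drop j w) in le_m uE dropE m_or *.
have au : avoids bad_o u by exact: avoids_take_drop.
have /allP := avoids_all_le avoiders_o_overlap au le_m.
have i'_in : i' \in iota 0 5 by rewrite mem_iota; lia.
move=> /(_ _ i'_in) /hasPn /(_ p); rewrite mem_iota p_gt0 lt_p => /(_ isT) /negP[].
have size_pu : p + p < size (drop i' (t u)).
  case: m_or => [size_u|r0].
    by have := avoids_all avoiders_o_size au size_u; rewrite size_drop; lia.
  by move/(congr1 size): dropE; rewrite r0 cats0 !size_drop; lia.
apply: nth_match_len => // k le_kp; have := match_len_nth lt_pm le_kp.
by rewrite dropE !nth_cat !ifT //; lia.
Qed.

(* The letter of w indexing a block that meets [[i, i + p]] is read off the first
   or the last letter of the block, whichever lies in that interval, so it is
   equal to the letter of the block shifted by the period. *)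
Lemma overlap_desubst (w : word) i p j0 j1 : i + p + p < size (t w) ->
  (forall k, i <= k <= i + p -> nth l0 (t w) (k + p) = nth l0 (t w) k) ->
  i <= cut w j0 <= i + p -> cut w j1 = cut w j0 + p -> j0 < j1 <= size w ->
  exists j m, [/\ 0 < m, j + m + m < size w &
    forall k, j <= k <= j + m -> nth l0 w (k + m) = nth l0 w k].
Proof.
move=> size_p eq_p /andP[le_ic le_cp] cut_j1 /andP[lt_j le_j1].
set m := j1 - j0.
have lt_cut j : cut w j < size (t w) -> j < size w.
  by move=> lt_c; rewrite ltnNge; apply: contraL lt_c => /cut_oversize ->; rewrite ltnn.
(* Moving right from the common boundary: the blocks at distance p have the same first letter, hence
   are equal, so the next boundaries correspond too. *)
have fwd d : cut w (j0 + d) <= i + p -> cut w (j0 + d + m) = cut w (j0 + d) + p.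
  elim: d => [|d IHd]; first by rewrite addn0 /m subnKC // ltnW.
  rewrite addnS addSn => le_d.
  have le_d' : cut w (j0 + d) <= i + p by apply: leq_trans le_d; exact: cut_leq.
  have cutE := IHd le_d'.
  have lt_d : j0 + d < size w by apply: lt_cut; lia.
  have lt_dm : j0 + d + m < size w by apply: lt_cut; lia.
  rewrite !cutS // cutE.
  have /andP[pos_d _] := size_t_letter (nth l0 w (j0 + d)).
  have /andP[pos_dm _] := size_t_letter (nth l0 w (j0 + d + m)).
  have le_cd : cut w j0 <= cut w (j0 + d) by apply: cut_leq; lia.
  have := eq_p (cut w (j0 + d)); rewrite -cutE le_d' (leq_trans le_ic) // => /(_ isT).
  rewrite -[cut w (j0 + d + m)]addn0 -[in X in _ = X -> _](addn0 (cut w (j0 + d))).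
  rewrite !nth_cut // !t_letter_first => ->.
  lia.
have last_eq j : j < size w -> j + m < size w -> i < cut w j.+1 <= i + p ->
    cut w (j.+1 + m) = cut w j.+1 + p -> nth l0 w (j + m) = nth l0 w j.
  move=> lt_j' lt_jm /andP[lt_i le_p] cutE.
  have /andP[pos_d _] := size_t_letter (nth l0 w j).
  have /andP[pos_dm _] := size_t_letter (nth l0 w (j + m)).
  rewrite addSn !cutS // in cutE; rewrite cutS // in lt_i le_p.
  have := eq_p (cut w j + (size (t_letter (nth l0 w j))).-1).
  rewrite (_ : cut w j + _ + p =
    cut w (j + m) + (size (t_letter (nth l0 w (j + m)))).-1); last by lia.
  rewrite !nth_cut ?prednK // !t_letter_last; apply; lia.
(* Moving left, the same with last letters, down to the block that contains position [i]. *)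
have bwd d : d <= j0 -> i < cut w (j0 - d).+1 -> cut w (j0 - d + m) = cut w (j0 - d) + p.
  elim: d => [|d IHd]; first by rewrite subn0 => _ _; rewrite /m subnKC // ltnW.
  move=> lt_d; have jE : (j0 - d.+1).+1 = j0 - d by lia.
  set j := j0 - d.+1 in jE *; rewrite -jE in IHd * => lt_i.
  have cutE : cut w (j.+1 + m) = cut w j.+1 + p.
    apply: IHd; first by lia.
    by apply: leq_trans lt_i _; exact: cut_leq.
  have lt_jw : j < size w by rewrite /j; lia.
  have lt_jm : j + m < size w by rewrite /j /m; lia.
  have le_jc : cut w j.+1 <= i + p by apply: leq_trans le_cp; apply: cut_leq; lia.
  have := last_eq _ lt_jw lt_jm _ cutE; rewrite lt_i le_jc => /(_ isT) eq_j.
  by rewrite addSn !cutS // eq_j in cutE; lia.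
have cut_shift j : cut w j <= i + p -> i < cut w j.+1 -> cut w (j + m) = cut w j + p.
  move=> le_jp lt_ij; have [le_j|lt_j'] := leqP j0 j.
    by rewrite -(subnKC le_j); apply: fwd; rewrite subnKC.
  by rewrite -(subKn (ltnW lt_j')); apply: bwd; rewrite ?leq_subr // subKn // ltnW.
have lt_i : i < size (t w) by lia.
have [j lt_jw /andP[le_ji lt_ij]] := cut_find lt_i.
have cut_jm : cut w (j + m) = cut w j + p by apply: cut_shift => //; lia.
have m_gt0 : 0 < m by rewrite /m; lia.
(* The boundary [j + m] lies p after the boundary [j], hence at most at [i + p], so blocks [j] to
   [j + m] all meet the interval. *)
have range k : j <= k <= j + m -> cut w k <= i + p /\ i < cut w k.+1.
  move=> /andP[le_jk le_km]; split.
    by apply: leq_trans (cut_leq w le_km) _; rewrite cut_jm; lia.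
  by apply: leq_trans lt_ij _; exact: cut_leq.
have cut_jmm : cut w (j + m + m) = cut w (j + m) + p.
  by have [] := range (j + m); rewrite ?leq_addr ?leqnn //; exact: cut_shift.
have size_j : j + m + m < size w by apply: lt_cut; lia.
exists j, m; split => // k le_k; have [le_kp lt_ik] := range k le_k.
have cut_k := cut_shift _ le_kp lt_ik.
have lt_kw : k < size w by lia.
have lt_kmw : k + m < size w by lia.
(* First letters are compared if block [k] starts in the interval; otherwise the block straddles
   [i], and its last letter lies in the interval. *)
have [le_ik|lt_ki] := leqP i (cut w k).
  have := eq_p (cut w k); rewrite le_ik le_kp -cut_k => /(_ isT).
  have /andP[pos_d _] := size_t_letter (nth l0 w k).
  have /andP[pos_dm _] := size_t_letter (nth l0 w (k + m)).
  rewrite -[cut w (k + m)]addn0 -[in X in _ = X -> _](addn0 (cut w k)).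
  by rewrite !nth_cut // !t_letter_first.
have lt_kj0 : k < j0.
  by rewrite ltnNge; apply/negP => /(cut_leq w); lia.
have le_ck : cut w k.+1 <= i + p by apply: leq_trans le_cp; exact: cut_leq.
apply: last_eq => //; first by rewrite lt_ik.
by apply: cut_shift => //; apply: leq_trans lt_ik _; exact: cut_leq.
Qed.

Lemma avoids_o_t (w : word) : avoids bad_o w -> avoids bad_o (t w).
Proof.
move=> aw v v_tw; rewrite negb_or; apply/andP; split.
  exact/sorted_adj_bad/(sorted_infix v_tw)/sorted_adj_t/avoids_o_sorted.
have /word_infixP[s1 [s2 twE]] := v_tw.
apply/hasPn => p; rewrite mem_iota => /andP[p_gt0 _]; apply/negP => lt_pm.
have size_pv := match_len_size lt_pm.
set i := size s1.
have drop_i : drop i (t w) = v ++ s2 by rewrite twE drop_size_cat.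
have nth_tw k : k < size v -> nth l0 (t w) (i + k) = nth l0 v k.
  by move=> lt_kv; rewrite -nth_drop drop_i nth_cat lt_kv.
have size_p : i + p + p < size (t w).
  by rewrite twE !size_cat -/i; lia.
have eq_p k : i <= k <= i + p -> nth l0 (t w) (k + p) = nth l0 (t w) k.
  move=> /andP[le_ik le_kp]; rewrite -(subnKC le_ik) -addnA !nth_tw; try lia.
  by rewrite addnC; apply: match_len_nth => //; lia.
have [lt_p|le_p] := ltnP p 24.
  have /negP[] := o_small i aw (p := p) (introT andP (conj p_gt0 lt_p)).
  rewrite drop_i; apply: nth_match_len; first by rewrite size_cat; lia.
  move=> k le_kp; rewrite !nth_cat !ifT; try lia.
  exact: match_len_nth.
(* As q <= 20 and p >= 24, this 2012 lies within the first p letters of the overlap and recurs p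
   places later. *)
have [|q le_q pq] := o_2012 (i := i) aw; first by lia.
have pqp : prefix l2012 (drop (i + q + p) (t w)).
  move: pq; rewrite !prefixE /= => /eqP <-; apply/eqP.
  have szl : size (take 4 (drop (i + q + p) (t w))) = 4.
    by rewrite size_takel // size_drop; lia.
  have szr : size (take 4 (drop (i + q) (t w))) = 4.
    by rewrite size_takel // size_drop; lia.
  apply/(@eq_from_nth _ l0); rewrite szl ?szr // => k lt_k.
  rewrite !nth_take // !nth_drop addnAC; apply: eq_p; lia.
have [j0 le_j0 cut_j0] := o_sync aw pq.
have [j1 le_j1 cut_j1] := o_sync aw pqp.
have [|||j [m [m_gt0 size_m eq_m]]] := overlap_desubst size_p eq_p (j0 := j0) (j1 := j1).
- by rewrite cut_j0; lia.
- by rewrite cut_j0 cut_j1; lia.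
- by rewrite le_j1 andbT ltnNge; apply/negP => /(cut_leq w); lia.
have /negP[] := aw _ (infix_drop w j); rewrite /bad_o; apply/orP; right.
apply/hasP; exists m.
  by rewrite mem_iota m_gt0 size_drop; lia.
apply: nth_match_len; first by rewrite size_drop; lia.
move=> k le_km; rewrite !nth_drop (addnC m) addnA; apply: eq_m; lia.
Qed.

Lemma avoids_o_iter n : avoids bad_o (iter n t [:: l0]).
Proof.
elim: n => [|n IHn]; last by rewrite iterS; exact: avoids_o_t.
move=> v /size_infix; case: v => [|x [|y v]] //=.
Qed.

(** * Palindromes of cyclic overlap-free words *)

Definition palindromes6 : seq word :=
  [:: [::]; [:: l0]; [:: l1]; [:: l2]; [:: l0; l0]; [:: l1; l1]].

(** Removing both end letters of a palindrome of length at least 5 leaves a palindrome, by induction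
    one of the six, hence of length at most 2: a contradiction. Length at most 4 is enumerated. *)
Lemma o_palindrome (v : word) : avoids bad_o v -> rev v = v ->
  v \in palindromes6.
Proof.
have short u : avoids bad_o u -> rev u = u -> size u <= 4 ->
    u \in palindromes6.
  move=> au ru le_u; pose P (u : word) := (rev u == u) ==>
    (u \in palindromes6).
  have checkP : all (fun k => all P (avoiders bad_o k)) (iota 0 5) by vm_compute.
  by have /implyP := avoids_all_le checkP au le_u; apply; apply/eqP.
have [n] := ubnP (size v); elim: n => // n IHn in v * => lt_v av rv.
case: (leqP (size v) 4) => [|lt4]; first exact: short.
case: v lt_v av rv lt4 => // x v; case/lastP: v => // v y lt_v av.
rewrite rev_cons rev_rcons => -[_ /rcons_inj[rv _]] lt4.
have {}av : avoids bad_o v.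
  by apply: avoids_infix av; apply: infix_trans (infix_rcons _ _) (infix_cons _ _).
have v_in : v \in _ := IHn v _ av rv.
have /allP/(_ v) : all (fun u : word => size u <= 2)
  palindromes6 by [].
rewrite /= size_rcons in lt_v lt4.
by rewrite v_in => [/(_ isT)|]; lia.
Qed.

Import Order.TTheory GRing.Theory Num.Theory.
Local Open Scope classical_set_scope.
Local Open Scope ring_scope.
Local Open Scope card_scope.

(** * Palindromes and powers in the fixed point *)

Lemma inf_factors_t_omegaP (v : word) :
  inf_factors t_omega v <-> exists n, infix v (iter n t [:: l0]).
Proof.
split=> [[i vE]|[n /word_infixP[p [s nE]]]].
  exists (i + size v)%N; have [lt_n prefix_n] := t_omega_limit (i + size v).
  rewrite prefix_n /inf_prefix; set N := size (iter _ t _) in lt_n *.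
  suff -> : v = take (size v) (drop i (mkseq t_omega N)).
    exact: infix_trans (infix_take _ _) (infix_drop _ _).
  have size_v : size (take (size v) (drop i (mkseq t_omega N))) = size v.
    by rewrite size_takel // size_drop size_mkseq; lia.
  apply/(@eq_from_nth _ l0); first by rewrite size_v.
  move=> j lt_j; rewrite nth_take // nth_drop nth_mkseq; last by lia.
  by rewrite {1}vE nth_mkseq.
have [_ prefix_n] := t_omega_limit n.
exists (size p); apply/(@eq_from_nth _ l0); first by rewrite size_mkseq.
move=> j lt_j; rewrite nth_mkseq //.
have <- : nth l0 (iter n t [:: l0]) (size p + j) = nth l0 v j.
  by rewrite nE nth_cat ltnNge leq_addr /= addKn nth_cat lt_j.
rewrite {1}prefix_n nth_mkseq // nE !size_cat; lia.
Qed.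

Lemma t_omega_avoids (v : word) : inf_factors t_omega v -> avoids bad_o v.
Proof. by move=> /inf_factors_t_omegaP[n /avoids_infix]; apply; exact: avoids_o_iter. Qed.

Lemma card_uniq (s : seq word) : uniq s -> [set` s] #= `I_(size s).
Proof.
move=> s_uniq; have -> : [set` s] = nth [::] s @` `I_(size s).
  apply/seteqP; split=> [x /= /(nthP [::])[i lt_i <-]|_ [i /= lt_i <-]].
    by exists i.
  exact: mem_nth.
have inj_nth : {in `I_(size s) &, injective (nth [::] s)}.
  by move=> i j /set_mem /= lt_i /set_mem /= lt_j /eqP; rewrite nth_uniq // => /eqP.
exact: inj_card_eq inj_nth.
Qed.

Lemma palindromes_t_omega : palindromes (inf_factors t_omega) #= `I_6.
Proof.
rewrite -[6%N]/(size palindromes6).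
rewrite (_ : palindromes _ = [set` palindromes6]).
  exact: card_uniq.
apply/seteqP; split=> [v [/t_omega_avoids av rv]|v /= v_in]; first exact: o_palindrome.
suff /andP[v3 /eqP rv] : infix v (iter 3 t [:: l0]) && (rev v == v).
  by split => //; apply/inf_factors_t_omegaP; exists 3%N.
by move: v v_in; apply/allP; vm_compute.
Qed.

Lemma t_omega_overlap_free : power_plus_free 2 (inf_factors t_omega).
Proof.
move=> r v /t_omega_avoids av lt_r [u [u0 _ vE rE]].
have u_gt0 : (0 < size u)%N by rewrite lt0n size_eq0; apply/eqP.
have size_v : (2 * size u < size v)%N.
  move: lt_r; rewrite -rE ltr_pdivlMr ?ltr0n // -natrM ltr_nat; lia.
have /negP[] := av _ (infix_refl v); apply/orP; right; apply/hasP; exists (size u).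
  by rewrite mem_iota; lia.
apply: nth_match_len => [|i le_i]; first by lia.
rewrite vE !nth_mkseq; try lia.
by rewrite /periodic_word modnDl.
Qed.

Lemma prefix_periodic (u x : word) : u != [::] -> prefix x (u ++ x) ->
  inf_prefix x (periodic_word u).
Proof.
move=> u0 /word_prefixP[s xE]; have u_gt0 : (0 < size u)%N by rewrite lt0n size_eq0.
apply/(@eq_from_nth _ l0) => [|i lt_i]; first by rewrite size_mkseq.
rewrite nth_mkseq // /periodic_word.
elim/ltn_ind: i lt_i => i IHi lt_i.
have -> : nth l0 x i = nth l0 (u ++ x) i by rewrite xE nth_cat lt_i.
rewrite nth_cat; case: ltnP => [lt_iu|le_ui]; first by rewrite modn_small.
rewrite IHi; try lia.
by rewrite -[in RHS](subnK le_ui) modnDr.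
Qed.

(** The word uuv has period |u| and exponent 2 + |v|/|u|, which is at least 9/4. *)
Lemma power_free_square (F : set word) (u v : word) :
  power_free (9 / 4) F -> u != [::] -> prefix v (u ++ v) ->
  (size u <= 4 * size v)%N -> ~ F (u ++ u ++ v).
Proof.
move=> free u0 vu le_size Fuuv.
have u_gt0 : (0 < size u)%N by rewrite lt0n size_eq0.
have le_r : 9 / 4 <= (size (u ++ u ++ v))%:R / (size u)%:R :> rat.
  have le_nat : (9 * size u <= 4 * size (u ++ u ++ v))%N by rewrite !size_cat; lia.
  rewrite ler_pdivlMr ?ltr0n //.
  have : (9 * size u)%:R <= (4 * size (u ++ u ++ v))%:R :> rat by rewrite ler_nat.
  rewrite !natrM; lra.
apply: (free _ _ Fuuv le_r); exists u; split => //.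
- exact/eqP.
- by apply: lt_le_trans le_r; lra.
- apply: prefix_periodic => //; case/word_prefixP: vu => s uvE.
  by apply/word_prefixP; exists s; rewrite -!catA -uvE.
Qed.

(** * Bi-infinite words: adjacency up to a permutation of the letters *)

Definition window (z : biinf_word) (i : int) (n : nat) : word :=
  mkseq (fun j => z (i + j%:Z)) n.

Lemma size_window z i n : size (window z i n) = n.
Proof. exact: size_mkseq. Qed.

Lemma biinf_window z i n : biinf_factors z (window z i n).
Proof. by exists i; rewrite size_window. Qed.

Lemma window_cat z i m n :
  window z i (m + n) = window z i m ++ window z (i + m%:Z) n.
Proof.
apply/(@eq_from_nth _ l0) => [|j]; rewrite ?size_cat !size_window // => lt_j.
rewrite nth_cat size_window nth_mkseq //; case: ltnP => le_j; rewrite nth_mkseq //; last lia.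
by rewrite -addrA -PoszD subnKC.
Qed.

Lemma infix_window z i n (v : word) : infix v (window z i n) ->
  exists k, v = window z k (size v).
Proof.
move=> /word_infixP[p [s wE]]; exists (i + (size p)%:Z).
have /(congr1 size) := wE; rewrite size_window !size_cat => nE.
apply/(@eq_from_nth _ l0) => [|j lt_j]; first by rewrite size_window.
have -> : nth l0 v j = nth l0 (window z i n) (size p + j).
  by rewrite wE nth_cat ltnNge leq_addr /= addKn nth_cat lt_j.
by rewrite !nth_mkseq //; [rewrite PoszD addrA | lia].
Qed.

Lemma biinf_infix z (u v : word) : infix u v -> biinf_factors z v -> biinf_factors z u.
Proof.
move=> uv [i vE]; move: uv; rewrite vE => /infix_window[k ->].
exact: biinf_window.
Qed.

Lemma window_avoids_z z i n : power_free (9 / 4) (biinf_factors z) ->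
  palindromes (biinf_factors z) #<= `I_6 -> avoids bad_z (window z i n).
Proof.
move=> free pal v v_w; have Fv : biinf_factors z v := biinf_infix v_w (biinf_window z i n).
rewrite /bad_z ifN; last first.
  apply/hasPn => p; rewrite mem_iota => /andP[p_gt0 _]; apply/negP => le_p.
  have [||sz_u sz_v uw vu] := @match_len_power p (match_len p v - p) v; try lia.
  apply: (power_free_square free _ vu); rewrite ?sz_u ?sz_v; try lia.
    by rewrite -size_eq0 sz_u; lia.
  exact: biinf_infix (prefixW uw) Fv.
rewrite -leqNgt -card_le_II -(card_le_eql (card_uniq (undup_uniq _))).
apply: card_le_trans pal; apply: subset_card_le => x x_in.
have : x \in short_palindromes v := x_in.
rewrite mem_undup mem_filter => /andP[/eqP rx /allpairsPdep[k [l [_ _ xE]]]].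
split=> //; apply: biinf_infix Fv; rewrite xE.
by apply: infix_trans (infix_take _ _) (infix_drop _ _).
Qed.

Definition adj_at (z : biinf_word) (i : int) (s : word) :=
  [&& all (mem (adj_pairs_of s)) (pairs (window z i 18)),
      all (mem (pairs (window z i 18))) (adj_pairs_of s)
    & all (mem (pairs (window z (i + 1) 18))) (adj_pairs_of s)].

Lemma adj_at_ex z i : power_free (9 / 4) (biinf_factors z) ->
  palindromes (biinf_factors z) #<= `I_6 -> exists2 s, s \in perms3 & adj_at z i s.
Proof.
move=> free pal; have av := @window_avoids_z z i 19 free pal.
have /hasP[s s_in] := avoids_all avoiders_z_adj av (size_window z i 19).
have -> : take 18 (window z i 19) = window z i 18.
  by rewrite (window_cat z i 18 1) take_size_cat // size_window.
have -> : behead (window z i 19) = window z (i + 1) 18.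
  by rewrite (window_cat z i 1 18).
by exists s.
Qed.

(* All the pairs allowed by s occur in the window at i + 1, where only pairs
   allowed by s' occur. *)
Lemma adj_at_unique z i s s' : s \in perms3 -> s' \in perms3 ->
  adj_at z i s -> adj_at z (i + 1) s' -> s = s'.
Proof.
move=> s_in s'_in /and3P[_ _ /allP sub1] /and3P[/allP sub2 _ _].
have sub : all (mem (adj_pairs_of s')) (adj_pairs_of s).
  by apply/allP => x /sub1 /sub2.
have /allP/(_ _ s_in)/allP/(_ _ s'_in)/implyP : all (fun s => all (fun s' =>
    all (mem (adj_pairs_of s')) (adj_pairs_of s) ==> (s == s')) perms3) perms3 by vm_compute.
by move=> /(_ sub) /eqP.
Qed.

Lemma adj_all z : power_free (9 / 4) (biinf_factors z) ->
  palindromes (biinf_factors z) #<= `I_6 ->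
  exists2 s, s \in perms3 & forall i, (z i, z (i + 1)) \in adj_pairs_of s.
Proof.
move=> free pal; have [s s_in s0] := @adj_at_ex z 0 free pal; exists s => // i.
suff /and3P[/allP/(_ (z i, z (i + 1))) + _ _] : adj_at z i s.
  by apply; rewrite /window /pairs /= addr0 inE eqxx.
(* From 0 in both directions, neighbouring windows having the same permutation. *)
elim/int_rect: i => // n IHn.
- have [s' s'_in] := @adj_at_ex z n.+1%:Z free pal.
  by rewrite -addn1 PoszD => s's; rewrite (adj_at_unique s_in s'_in IHn s's).
have [s' s'_in s's] := @adj_at_ex z (- n.+1%:Z) free pal.
have nE : - n.+1%:Z + 1 = - n%:Z by lia.
by rewrite -(adj_at_unique s'_in s_in s's) // nE.
Qed.

Lemma rename_inj s : s \in perms3 -> injective (rename s).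
Proof.
move=> s_in x y; apply: contra_eq => neq_xy.
have /allP/(_ _ s_in)/allP/(_ _ (letterP x))/allP/(_ _ (letterP y))/implyP :
  all (fun s => all (fun x => all (fun y => (x != y) ==> (rename s x != rename s y))
    [:: l0; l1; l2]) [:: l0; l1; l2]) perms3 by vm_compute.
exact.
Qed.

(** * Renaming of letters and equality of factor sets *)

Lemma biinf_factors_map (f : letter -> letter) z v :
  biinf_factors z v -> biinf_factors (f \o z) (map f v).
Proof.
move=> [i vE]; exists i; rewrite {1}vE size_map /mkseq -map_comp; exact: eq_map.
Qed.

Lemma inf_factors_map (f : letter -> letter) w v :
  inf_factors w v -> inf_factors (f \o w) (map f v).
Proof.
move=> [i vE]; exists i; rewrite {1}vE size_map /mkseq -map_comp; exact: eq_map.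
Qed.

(** Here [z] is the renamed word and [f \o z] the given one: renaming maps a forbidden uuv of [z] to
    a word of the same shape in [f \o z]. *)
Lemma window_avoids_q z (f : letter -> letter) i n : injective f ->
  power_free (9 / 4) (biinf_factors (f \o z)) ->
  (forall i, adj (z i) (z (i + 1))) -> avoids bad_q (window z i n).
Proof.
move=> f_inj free adj_z v /infix_window[k vE]; rewrite negb_or; apply/andP; split.
  by rewrite vE; case: (size v) => [|[|m]] //=; rewrite negbK addr0.
apply/negP => /bad_powerP[u [x [u0 /prefixW uw xu le_size _]]].
have /(biinf_factors_map f) : biinf_factors z (u ++ u ++ x).
  by apply: biinf_infix uw _; rewrite vE; exact: biinf_window.
rewrite !map_cat; apply: power_free_square; rewrite ?size_map //.
  by rewrite -size_eq0 size_map size_eq0.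
by case/word_prefixP: xu => s uxE; apply/word_prefixP; exists (map f s); rewrite -!map_cat uxE.
Qed.

Lemma biinf_factors_q z : (forall i n, avoids bad_q (window z i n)) ->
  biinf_factors z = inf_factors t_omega.
Proof.
move=> aq; apply/seteqP; split=> [v [i vE]|v /inf_factors_t_omegaP[n v_n]].
  apply/inf_factors_t_omegaP; have [M HM] := q_factor (size v).
  apply: (HM (window z (i - M%:Z) M) v (window z (i + (size v)%:Z) M)).
  - have := aq (i - M%:Z) (M + (size v + M))%N.
    by rewrite !window_cat subrK -[window z i (size v)]/(mkseq _ _) -vE.
  - by [].
  - by rewrite size_window.
  - by rewrite size_window.
have [M HM] := q_contains n.
apply: biinf_infix (biinf_window z 0 M); apply: infix_trans v_n _.
by apply: HM => //; rewrite size_window.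
Qed.

Theorem theorem5 :
  [/\ palindromes (inf_factors t_omega) #= `I_6,
      power_plus_free 2 (inf_factors t_omega)
    & forall z : biinf_word,
        power_free (9 / 4) (biinf_factors z) ->
        palindromes (biinf_factors z) #<= `I_6 ->
        exists s : {perm letter},
          biinf_factors z = inf_factors (s \o t_omega)].
Proof.
split=> [||z free pal]; first exact: palindromes_t_omega.
  exact: t_omega_overlap_free.
have [p p_in adj_z] := adj_all free pal.
pose s := perm (rename_inj p_in); exists s.
(* Undoing the permutation makes the word cyclic in the standard order of letters. *)
pose y : biinf_word := (s^-1)%g \o z.
have zE : z = s \o y by apply/funext => i; rewrite /= permKV.
have adj_y i : adj (y i) (y (i + 1)).
  have /mapP[[a b] ab_in [za zb]] := adj_z i.
  have permE x : rename p x = s x by rewrite permE.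
  by rewrite /adj /y /= za zb !permE !permK.
have yE : biinf_factors y = inf_factors t_omega.
  apply: biinf_factors_q => i n; apply: (window_avoids_q (f := s)) => //.
    exact: perm_inj.
  by rewrite -zE.
have mapsK v : map s (map (s^-1)%g v) = v by rewrite -map_comp map_id_in // => x _; exact: permKV.
apply/seteqP; split=> v.
  move=> /(biinf_factors_map (s^-1)%g); rewrite -/y yE => /(inf_factors_map s).
  by rewrite mapsK.
move=> /(inf_factors_map (s^-1)%g); rewrite (_ : _ \o _ = t_omega); last first.
  by apply/funext => i /=; rewrite permK.
by rewrite -yE => /(biinf_factors_map s); rewrite mapsK -zE.
Qed.
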